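(* Let $S$ be a semidomain. A factorization of an invertible integral ideal $\mathfrak{a}$ of $S$ into prime ideals $\mathfrak{p}_1\mathfrak{p}_2\cdots\mathfrak{p}_k$ is unique, up to the permutation of the $\mathfrak{p}_i$'s.
   Context: A semiring is $(S,+,\cdot,0,1)$ where $(S,+,0)$ and $(S,\cdot,1)$ are commutative monoids, $1\neq 0$, multiplication distributes over addition, and $a\cdot 0=0$ for all $a$. A semidomain is a semiring $S$ in which $ab=ac$ with $a\neq 0$ implies $b=c$. Its semifield of fractions $K=F(S)$ is the localization of $S$ at $S-\{0\}$. An (integral) ideal of $S$ is a nonempty subset of $S$ closed under addition and under multiplication by elements of $S$. A prime ideal is a proper ideal $\mathfrak{p}$ such that $ab\in\mathfrak{p}$ implies $a\in\mathfrak{p}$ or $b\in\mathfrak{p}$. A fractional ideal of $S$ is a nonempty subset $A\subseteq K$ closed under addition and under multiplication by elements of $S$ such that $dA\subseteq S$ for some nonzero $d\in S$. The product of (fractional) ideals $A,B$ is $AB=\{\sum_{i=1}^n a_ib_i: a_i\in A, b_i\in B\}$, and $A$ is invertible if $AB=S$ for some fractional ideal $B$. *)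

(* Defs.v *)
From HB Require Import structures.
From mathcomp Require Import all_boot all_order all_algebra.
From mathcomp Require Import generic_quotient ring.
From mathcomp Require Import boolp classical_sets.

Set Implicit Arguments.
Unset Strict Implicit.
Unset Printing Implicit Defensive.

Import GRing.Theory.
Local Open Scope ring_scope.

(* A comNzSemiRingType is exactly a commutative semiring with 1 != 0. *)
HB.mixin Record ComNzSemiRing_isSemidomain S of GRing.ComNzSemiRing S := {
  semidomain_mulI : forall a b c : S, a != 0 -> a * b = a * c -> b = c
}.

#[short(type="semidomainType")]
HB.structure Definition Semidomain :=
  {S of GRing.ComNzSemiRing S & ComNzSemiRing_isSemidomain S}.

Lemma semidomain_mul_neq0 (S : semidomainType) (a b : S) :
  a != 0 -> b != 0 -> a * b != 0.
Proof.
move=> a0; apply: contraNneq => ab0; apply/eqP.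
by apply: (semidomain_mulI _ _ _ a0); rewrite ab0 mulr0.
Qed.

(* The localization of S at S - {0}, built like {fraction R} of
   mathcomp.algebra.fraction, which requires R to be a ring. *)
Module SemifracField.
Section SemifracField.
Variable S : semidomainType.

Record ratio := Ratio { frac : S * S; den_neq0 : frac.2 != 0 }.

HB.instance Definition _ := [isSub for frac].
HB.instance Definition _ := [Choice of ratio by <:].

Implicit Types x y z : ratio.

Local Notation num x := (frac x).1.
Local Notation den x := (frac x).2.

Definition equivf x y := num x * den y == den x * num y.

Lemma equivf_refl : reflexive equivf.
Proof. by move=> x; rewrite /equivf mulrC. Qed.

Lemma equivf_sym : symmetric equivf.
Proof. by move=> x y; rewrite /equivf eq_sym; congr (_ == _); rewrite mulrC. Qed.

Lemma equivf_trans : transitive equivf.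
Proof.
move=> [[b b'] /= Pb] [[a a'] /= Pa] [[c c'] /= Pc].
rewrite /equivf /= => /eqP ab /eqP bc; apply/eqP.
apply: (semidomain_mulI _ _ _ Pb).
have -> : b' * (a * c') = (a * b') * c' by ring.
have -> : b' * (a' * c) = a' * (b' * c) by ring.
by rewrite ab -bc mulrA.
Qed.

Canonical equivf_equiv := EquivRel equivf equivf_refl equivf_sym equivf_trans.

Definition type := {eq_quot equivf}%qT.

HB.instance Definition _ : EqQuotient _ equivf type := EqQuotient.on type.
HB.instance Definition _ := Choice.on type.

Definition pi (x : ratio) : type := \pi_type%qT x.

Lemma pi_eq x y : (pi x = pi y) <-> num x * den y = den x * num y.
Proof.
split=> [/eqmodP /eqP //|e]; apply/eqmodP/eqP; exact: e.
Qed.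

Lemma piK (a : type) : pi (repr a) = a.
Proof. exact: reprK. Qed.

Lemma piP (a : type) : exists x, a = pi x.
Proof. by exists (repr a); rewrite piK. Qed.

Definition ofS (s : S) : ratio := @Ratio (s, 1) (oner_neq0 S).

Definition addf x y : ratio :=
  @Ratio (num x * den y + num y * den x, den x * den y)
    (semidomain_mul_neq0 (den_neq0 x) (den_neq0 y)).

Definition mulf x y : ratio :=
  @Ratio (num x * num y, den x * den y)
    (semidomain_mul_neq0 (den_neq0 x) (den_neq0 y)).

Definition tofrac (s : S) : type := pi (ofS s).
Definition add (a b : type) : type := pi (addf (repr a) (repr b)).
Definition mul (a b : type) : type := pi (mulf (repr a) (repr b)).

Lemma pi_add x y : add (pi x) (pi y) = pi (addf x y).
Proof.
apply/pi_eq => /=.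
have /pi_eq ex := piK (pi x); have /pi_eq ey := piK (pi y).
set x' := repr (pi x) in ex *; set y' := repr (pi y) in ey *.
transitivity ((num x' * den x) * (den y' * den y) +
              (num y' * den y) * (den x' * den x)); first by ring.
by rewrite ex ey; ring.
Qed.

Lemma pi_mul x y : mul (pi x) (pi y) = pi (mulf x y).
Proof.
apply/pi_eq => /=.
have /pi_eq ex := piK (pi x); have /pi_eq ey := piK (pi y).
set x' := repr (pi x) in ex *; set y' := repr (pi y) in ey *.
transitivity ((num x' * den x) * (num y' * den y)); first by ring.
by rewrite ex ey; ring.
Qed.

Lemma addA : associative add.
Proof.
move=> a b c; case: (piP a) (piP b) (piP c) => [x ->] [y ->] [z ->].
by rewrite !pi_add; apply/pi_eq => /=; ring.
Qed.

Lemma addC : commutative add.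
Proof.
move=> a b; case: (piP a) (piP b) => [x ->] [y ->].
by rewrite !pi_add; apply/pi_eq => /=; ring.
Qed.

Lemma add0 : left_id (tofrac 0) add.
Proof.
move=> a; case: (piP a) => [x ->].
by rewrite !pi_add; apply/pi_eq => /=; ring.
Qed.

HB.instance Definition _ := GRing.isNmodule.Build type addA addC add0.

Lemma mulA : associative mul.
Proof.
move=> a b c; case: (piP a) (piP b) (piP c) => [x ->] [y ->] [z ->].
by rewrite !pi_mul; apply/pi_eq => /=; ring.
Qed.

Lemma mulC : commutative mul.
Proof.
move=> a b; case: (piP a) (piP b) => [x ->] [y ->].
by rewrite !pi_mul; apply/pi_eq => /=; ring.
Qed.

Lemma mul1 : left_id (tofrac 1) mul.
Proof.
move=> a; case: (piP a) => [x ->].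
by rewrite !pi_mul; apply/pi_eq => /=; ring.
Qed.

Lemma mulDl : left_distributive mul add.
Proof.
move=> a b c; case: (piP a) (piP b) (piP c) => [x ->] [y ->] [z ->].
by rewrite pi_add !pi_mul pi_add; apply/pi_eq => /=; ring.
Qed.

Lemma mul0 : left_zero (tofrac 0) mul.
Proof.
move=> a; case: (piP a) => [x ->].
by rewrite !pi_mul; apply/pi_eq => /=; ring.
Qed.

Lemma one_neq0 : tofrac 1 != tofrac 0.
Proof. by apply/eqP => /pi_eq /=; rewrite !mul1r => /eqP; rewrite oner_eq0. Qed.

HB.instance Definition _ := GRing.Nmodule_isComNzSemiRing.Build type
  mulA mulC mul1 mulDl mul0 one_neq0.

End SemifracField.
End SemifracField.
HB.export SemifracField.

Notation "{ 'semifrac' S }" := (SemifracField.type S)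
  (at level 0, format "{ 'semifrac'  S }") : type_scope.

Definition tosemifrac (S : semidomainType) : S -> {semifrac S} :=
  @SemifracField.tofrac S.

Section SemifracTheory.
Variable S : semidomainType.

Lemma tosemifrac_is_nmod_morphism : nmod_morphism (@tosemifrac S).
Proof.
split=> // a b; rewrite [RHS]SemifracField.pi_add.
by apply/SemifracField.pi_eq => /=; ring.
Qed.

HB.instance Definition _ := GRing.isNmodMorphism.Build S {semifrac S}
  (@tosemifrac S) tosemifrac_is_nmod_morphism.

Lemma tosemifrac_is_monoid_morphism : monoid_morphism (@tosemifrac S).
Proof.
split=> // a b; rewrite [RHS]SemifracField.pi_mul.
by apply/SemifracField.pi_eq => /=; ring.
Qed.

HB.instance Definition _ := GRing.isMonoidMorphism.Build S {semifrac S}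
  (@tosemifrac S) tosemifrac_is_monoid_morphism.

Lemma tosemifrac_inj : injective (@tosemifrac S).
Proof. by move=> a b /SemifracField.pi_eq /=; rewrite mulr1 mul1r. Qed.

Lemma semifracP (x : {semifrac S}) :
  exists a b : S, b != 0 /\ tosemifrac b * x = tosemifrac a.
Proof.
case: (SemifracField.piP x) => [[[a b] /= b0] ->]; exists a, b; split=> //.
rewrite [LHS]SemifracField.pi_mul.
by apply/SemifracField.pi_eq => /=; ring.
Qed.

Lemma semifrac_inv (x : {semifrac S}) :
  x != 0 -> exists y : {semifrac S}, x * y = 1.
Proof.
case: (SemifracField.piP x) => [[[a b] /= b0] ->] x0.
have a0 : a != 0.
  apply: contraNneq x0 => a0; apply/eqP/SemifracField.pi_eq => /=.
  by rewrite a0 mul0r mulr0.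
exists (SemifracField.pi (@SemifracField.Ratio S (b, a) a0)).
rewrite [LHS]SemifracField.pi_mul.
by apply/SemifracField.pi_eq => /=; ring.
Qed.

End SemifracTheory.

Section Ideals.
Local Open Scope classical_set_scope.

(* The case n = 0 only contributes 0, which belongs to every ideal. *)
Definition ideal_mul (R : comNzSemiRingType) (A B : set R) : set R :=
  [set x | exists (n : nat) (a b : 'I_n -> R),
     [/\ forall i, A (a i), forall i, B (b i) & x = \sum_(i < n) a i * b i]].

Variable S : semidomainType.

Definition integral_ideal (I : set S) : Prop :=
  [/\ I !=set0,
      forall a b, I a -> I b -> I (a + b) &
      forall s a, I a -> I (s * a)].

Definition prime_ideal (P : set S) : Prop :=
  [/\ integral_ideal P,
      P <> setT &
      forall a b, P (a * b) -> P a \/ P b].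

Definition fractional_ideal (A : set {semifrac S}) : Prop :=
  [/\ A !=set0,
      forall x y, A x -> A y -> A (x + y),
      forall (s : S) x, A x -> A (tosemifrac s * x) &
      exists2 d : S, d != 0 &
        [set tosemifrac d * x | x in A] `<=` range (@tosemifrac S)].

Definition invertible (A : set {semifrac S}) : Prop :=
  exists2 B, fractional_ideal B & ideal_mul A B = range (@tosemifrac S).

(* p_1 p_2 ... p_k; the empty product is the unit ideal S. *)
Definition ideal_prod (ps : seq (set S)) : set S :=
  \big[@ideal_mul S/setT]_(p <- ps) p.

End Ideals.

(* Main.v *)
(** Localizing shows that an invertible ideal can be cancelled from products of
    ideals, and so can every factor of it. Choose [p] minimal among the [p_i].
    Since [q_1 ... q_m] is contained in [p], some [q_j] is; since [p_1 ... p_k]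
    is contained in [q_j], some [p_i] is, so [p_i = q_j = p] by minimality.
    Cancel [p] and induct on the number of factors. *)

Require Import Defs.
From mathcomp Require Import all_boot all_order all_algebra.
From mathcomp Require Import boolp classical_sets.

Local Open Scope classical_set_scope.

Import GRing.Theory.
Local Open Scope ring_scope.

Section IdealMul.
Variable R : comNzSemiRingType.
Implicit Types A B C : set R.

Lemma ideal_mulM A B x y : A x -> B y -> ideal_mul A B (x * y).
Proof.
move=> Ax By; exists 1, (fun=> x), (fun=> y); split=> //.
by rewrite big_ord1.
Qed.

Lemma ideal_mul0 A B : ideal_mul A B 0.
Proof.
exists 0, (fun=> 0), (fun=> 0); split; [by case | by case |].
by rewrite big_ord0.
Qed.

Lemma ideal_mulD A B x y :
  ideal_mul A B x -> ideal_mul A B y -> ideal_mul A B (x + y).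
Proof.
move=> [m [a [b [Aa Bb ->]]]] [n [c [d [Ac Bd ->]]]].
(* [glue] concatenates the families of terms of the two sums into one indexed by ['I_(m + n)]. *)
pose glue (f : 'I_m -> R) (g : 'I_n -> R) (i : 'I_(m + n)) :=
  match split i with inl j => f j | inr k => g k end.
exists (m + n)%N, (glue a c), (glue b d); split.
- by move=> i; rewrite /glue; case: split.
- by move=> i; rewrite /glue; case: split.
- rewrite big_split_ord; congr (_ + _); apply: eq_bigr => i _; rewrite /glue.
    by rewrite -[lshift n i]/(unsplit (inl i)) unsplitK.
  by rewrite -[rshift m i]/(unsplit (inr i)) unsplitK.
Qed.

(** The induction principle for products: inclusions are checked on single products [x * y], without
    handling finite sums again. *)
Lemma ideal_mul_min A B C :
    C 0 -> (forall x y, C x -> C y -> C (x + y)) ->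
    (forall x y, A x -> B y -> C (x * y)) ->
  ideal_mul A B `<=` C.
Proof.
move=> C0 CD CM x [n [a [b [Aa Bb ->]]]].
by apply: (big_ind C) => // i _; apply: CM.
Qed.

Lemma ideal_mulC A B : ideal_mul A B = ideal_mul B A.
Proof.
suff le A' B' : ideal_mul A' B' `<=` ideal_mul B' A'.
  by apply/seteqP; split; apply: le.
apply: ideal_mul_min => [|x y|x y A'x B'y]; first exact: ideal_mul0.
  exact: ideal_mulD.
by rewrite mulrC; apply: ideal_mulM.
Qed.

Lemma ideal_mulA A B C :
  ideal_mul A (ideal_mul B C) = ideal_mul (ideal_mul A B) C.
Proof.
have le A' B' C' :
    ideal_mul A' (ideal_mul B' C') `<=` ideal_mul (ideal_mul A' B') C'.
  apply: ideal_mul_min => [|x y|x y A'x]; first exact: ideal_mul0.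
    exact: ideal_mulD.
  move: y; apply: ideal_mul_min => [|y z|y z B'y C'z] /=.
  - by rewrite mulr0; apply: ideal_mul0.
  - by rewrite mulrDr; apply: ideal_mulD.
  - by rewrite mulrA; do 2?apply: ideal_mulM.
apply/seteqP; split; first exact: le.
(* By commutativity the reverse inclusion is [le] applied to [C], [B], [A]. *)
rewrite ideal_mulC (ideal_mulC A B) (ideal_mulC A) (ideal_mulC B C).
exact: le.
Qed.

Lemma ideal_mulCA A B C :
  ideal_mul A (ideal_mul B C) = ideal_mul B (ideal_mul A C).
Proof. by rewrite !ideal_mulA (ideal_mulC A). Qed.

End IdealMul.

(** Used with [tosemifrac] to move an equation between products of ideals into the semifield of
    fractions, where the inverse lives. *)
Lemma image_ideal_mul (R R' : comNzSemiRingType) (f : {rmorphism R -> R'})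
    (A B : set R) :
  f @` ideal_mul A B = ideal_mul (f @` A) (f @` B).
Proof.
apply/seteqP; split.
  move=> _ [_ [n [a [b [Aa Bb ->]]]] <-].
  exists n, (f \o a), (f \o b).
  split=> [i|i|]; [by exists (a i) | by exists (b i) |].
  by rewrite rmorph_sum; apply: eq_bigr => i _; rewrite rmorphM.
apply: ideal_mul_min.
- by exists 0; [apply: ideal_mul0 | rewrite rmorph0].
- move=> _ _ [x ABx <-] [y ABy <-].
  by exists (x + y); [apply: ideal_mulD | rewrite rmorphD].
- move=> _ _ [x Ax <-] [y By <-].
  by exists (x * y); [apply: ideal_mulM | rewrite rmorphM].
Qed.

Lemma seq_set_minimal (T : Type) (s : seq (set T)) : s != [::] ->
  exists2 m, m \in s & forall x, x \in s -> x `<=` m -> x = m.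
Proof.
elim: s => // x [_ _|y s IHs _].
  by exists x => [|z]; rewrite !inE // => /eqP.
have [//|m ms min_m] := IHs.
(* If [x] lies in [m], then [x] is minimal: any [z] of the tail inside [x] is inside [m], hence
   equals [m] and contains [x]. *)
have [xm|nxm] := pselect (x `<=` m).
  exists x => [|z]; first exact: mem_head.
  rewrite inE => /predU1P[//|zs zx]; apply/seteqP; split=> //.
  by rewrite (min_m z zs (subset_trans zx xm)).
exists m => [|z]; first by rewrite inE ms orbT.
by rewrite inE => /predU1P[-> /nxm|/min_m].
Qed.

Section UniqueFactorization.
Variable S : semidomainType.
Implicit Types (a p q X Y : set S) (ps qs : seq (set S)).

Lemma integral_ideal0 a : integral_ideal a -> a 0.
Proof. by case=> [[x ax] _ aM]; rewrite -(mul0r x); apply: aM. Qed.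

Lemma integral_ideal_setT : integral_ideal (setT : set S).
Proof. by split=> //; exists 0. Qed.

Lemma integral_ideal_mul a X :
  integral_ideal a -> integral_ideal (ideal_mul a X).
Proof.
move=> [_ _ aM]; split=> [|x y|s]; first by exists 0; apply: ideal_mul0.
  exact: ideal_mulD.
apply: ideal_mul_min => [|x y|x y ax Xy] /=.
- by rewrite mulr0; apply: ideal_mul0.
- by rewrite mulrDr; apply: ideal_mulD.
- by rewrite mulrA; apply: ideal_mulM => //; apply: aM.
Qed.

Lemma ideal_mul_subl a X : integral_ideal a -> ideal_mul a X `<=` a.
Proof.
move=> ida; have [_ aD aM] := ida.
apply: ideal_mul_min => [||x y ax _]; [exact: integral_ideal0 | exact: aD |].
by rewrite mulrC; apply: aM.
Qed.

(** If some [x] in [X] is outside [p], then [x * y] in [p] forces every [y] in [Y] into [p]. *)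
Lemma prime_ideal_mul p X Y :
  prime_ideal p -> ideal_mul X Y `<=` p -> X `<=` p \/ Y `<=` p.
Proof.
move=> [_ _ pP] XYp; have [|nXp] := pselect (X `<=` p); [by left | right].
have [x [Xx npx]] : exists x, X x /\ ~ p x.
  by apply: contrapT => nex; apply: nXp => x Xx; apply: contrapT => npx;
    apply: nex; exists x.
by move=> y Yy; case: (pP x y) => //; apply: XYp; apply: ideal_mulM.
Qed.

Lemma integral_ideal_prod ps :
  (forall p, p \in ps -> integral_ideal p) -> integral_ideal (ideal_prod ps).
Proof.
(* The first factor absorbs scalars for the whole product, so a case split replaces an induction. *)
rewrite /ideal_prod; case: ps => [_|p ps idps].
  by rewrite big_nil; apply: integral_ideal_setT.
by rewrite big_cons; apply: integral_ideal_mul; apply: idps; apply: mem_head.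
Qed.

Lemma ideal_prod_rem p ps :
  p \in ps -> ideal_prod ps = ideal_mul p (ideal_prod (rem p ps)).
Proof.
rewrite /ideal_prod; elim: ps => // q ps IHps.
rewrite inE big_cons /= eq_sym.
case: eqP => [-> //|_ /= /IHps ->].
by rewrite big_cons ideal_mulCA.
Qed.

Lemma ideal_prod_sub p ps :
  integral_ideal p -> p \in ps -> ideal_prod ps `<=` p.
Proof. by move=> idp /ideal_prod_rem ->; apply: ideal_mul_subl. Qed.

Lemma prime_ideal_prod p qs : prime_ideal p -> ideal_prod qs `<=` p ->
  exists2 q, q \in qs & q `<=` p.
Proof.
move=> prp; rewrite /ideal_prod; elim: qs => [|q qs IHqs].
  (* The empty product is all of [S], which the proper ideal [p] cannot contain. *)
  by rewrite big_nil => Tp; case: prp => _ [] //; apply/seteqP; split.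
rewrite big_cons => /(prime_ideal_mul _ _ _ prp)[qp|/IHqs[r rqs rp]].
  by exists q => //; apply: mem_head.
by exists r => //; rewrite inE rqs orbT.
Qed.

(** The consequence of invertibility that the induction carries: it passes to factors and is stated
    inside [S]. *)
Definition cancellable a := forall X Y,
  integral_ideal X -> integral_ideal Y ->
  ideal_mul a X = ideal_mul a Y -> X = Y.

Lemma cancellable_mulr a X : cancellable (ideal_mul a X) -> cancellable X.
Proof.
by move=> caX Y Z idY idZ eqYZ; apply: caX => //; rewrite -!ideal_mulA eqYZ.
Qed.

Lemma cancellable_mull a X : cancellable (ideal_mul a X) -> cancellable a.
Proof. by rewrite ideal_mulC; apply: cancellable_mulr. Qed.

(** The copy of [S] in its fractions acts as a unit: [X] absorbs scalars, and [1] gives the other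
    inclusion. *)
Lemma range_tosemifrac_mul X : integral_ideal X ->
  ideal_mul (range (@tosemifrac S)) (@tosemifrac S @` X) = @tosemifrac S @` X.
Proof.
move=> idX; rewrite -image_ideal_mul; congr (_ @` _).
apply/seteqP; split; first by rewrite ideal_mulC; apply: ideal_mul_subl.
by move=> x Xx; rewrite -(mul1r x); apply: ideal_mulM.
Qed.

Lemma invertible_cancellable a :
  invertible (@tosemifrac S @` a) -> cancellable a.
Proof.
move=> [B _ aB] X Y idX idY /(congr1 (image^~ (@tosemifrac S))).
(* Multiplying by the inverse [B] leaves the images of [X] and [Y], and injectivity of [tosemifrac]
   brings the equality back to [S]. *)
rewrite /= !image_ideal_mul => /(congr1 (ideal_mul B)).
rewrite !ideal_mulA (ideal_mulC _ B) aB !range_tosemifrac_mul //.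
move=> eqXY; apply/funext => x.
by rewrite -!(image_inj (@tosemifrac_inj S)) eqXY.
Qed.

Lemma cancellable_prime_factorization ps qs :
    (forall p, p \in ps -> prime_ideal p) ->
    (forall q, q \in qs -> prime_ideal q) ->
    cancellable (ideal_prod ps) -> ideal_prod ps = ideal_prod qs ->
  perm_eq ps qs.
Proof.
have primeI p : prime_ideal p -> integral_ideal p by case.
have [n] := ubnP (size ps).
elim: n => // n IHn in ps qs *; rewrite ltnS => sz_ps prps prqs cps eq_pq.
(* If [ps] is empty, the common product is [S]; a first prime [q] of [qs] would contain it, against
   properness. *)
have [ps0|ps_n0] := eqVneq ps [::].
  case: qs => [|q qs] in prqs eq_pq *; first by rewrite ps0.
  have prq := prqs q (mem_head _ _); case: (prq) => _ [].
  apply/seteqP; split=> //.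
  have -> : setT = ideal_prod ps by rewrite ps0 /ideal_prod big_nil.
  rewrite eq_pq; apply: ideal_prod_sub; [exact: primeI | exact: mem_head].
have [p p_ps min_p] := seq_set_minimal _ _ ps_n0.
have idp := primeI _ (prps _ p_ps).
have [|q q_qs qp] := prime_ideal_prod _ qs (prps _ p_ps).
  by rewrite -eq_pq; apply: ideal_prod_sub.
have [|p' p'_ps p'q] := prime_ideal_prod _ ps (prqs _ q_qs).
  by rewrite eq_pq; apply: ideal_prod_sub => //; apply/primeI/prqs.
have eqp' := min_p _ p'_ps (subset_trans p'q qp).
have eq_qp : q = p by apply/seteqP; split=> //; rewrite -eqp'.
move: q_qs; rewrite {}eq_qp => p_qs.
rewrite (ideal_prod_rem _ _ p_ps) in cps eq_pq.
rewrite (ideal_prod_rem _ _ p_qs) in eq_pq.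
have prps' r : r \in rem p ps -> prime_ideal r by move/mem_rem/prps.
have prqs' r : r \in rem p qs -> prime_ideal r by move/mem_rem/prqs.
rewrite (permPl (perm_to_rem p_ps)) (permPr (perm_to_rem p_qs)) perm_cons.
(* [cps] serves twice: its right factor supplies the induction hypothesis, its left factor [p] is
   cancelled from [eq_pq]. *)
apply: IHn => //; last 2 first.
- exact: cancellable_mulr cps.
- apply: (cancellable_mull _ _ cps) eq_pq; apply: integral_ideal_prod => r.
    by move/prps'/primeI.
  by move/prqs'/primeI.
(* Nonemptiness of [ps] makes the truncated predecessor of its size strictly smaller. *)
- by rewrite size_rem //; case: (ps) ps_n0 sz_ps.
Qed.

End UniqueFactorization.

Local Close Scope ring_scope.

(* perm_eq compares sets through the classical equality on set S. *)
Theorem proposition2p11 (S : semidomainType) (a : set S)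
    (ps qs : seq (set S)) :
  integral_ideal a ->
  invertible (@tosemifrac S @` a) ->
  (forall p : set S, p \in ps -> prime_ideal p) ->
  (forall q : set S, q \in qs -> prime_ideal q) ->
  a = ideal_prod ps ->
  a = ideal_prod qs ->
  perm_eq ps qs.
Proof.
move=> _ inva prps prqs eq_ap eq_aq.
apply: cancellable_prime_factorization => //; rewrite -eq_ap //.
exact: invertible_cancellable.
Qed.
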